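(* Let $S$ be a non-negative square matrix with $\gamma(S)=c$, let $k$ be a natural number and let $\varepsilon$ be a positive number. Then there is a natural number $$m<(4c/\varepsilon)\,k^{(2ck^2/\varepsilon)^{k^2}}$$ which is a power of $k$, and an element $X\in C(S,m)$, such that $\mathrm{dist}(C(X,k),C(S,k))\leq\varepsilon$.
   Context: For a matrix $S$, $\gamma(S)$ denotes the sum of its entries. $\mathcal{K}(k,n)$ is the set of all non-negative real $k\times n$ matrices with every row sum equal to $n/k$ and every column sum equal to $1$. For an $n\times n$ matrix $S$ and a positive integer $k$, $C(S,k)=\{MSM^T : M\in\mathcal{K}(k,n)\}\subset\mathbb{R}^{k\times k}$. $\mathrm{dist}$ is the Hausdorff distance between compact subsets of $\mathbb{R}^{k\times k}$ induced by the entrywise $\ell_1$ norm.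
   Formalization: Adds the hypothesis that the bound (4c/ε)k^((2ck²/ε)^(k²)) exceeds 1; otherwise no power of k (always at least 1) lies below it, e.g. for S = 0, and the claim fails. *)

(* Defs.v *)
From HB Require Import structures.
From mathcomp Require Import all_boot all_order all_algebra.
From mathcomp Require Import all_classical all_reals all_analysis.

Set Implicit Arguments.
Unset Strict Implicit.
Unset Printing Implicit Defensive.

Import Order.TTheory GRing.Theory Num.Theory.

Local Open Scope classical_set_scope.
Local Open Scope ring_scope.

Definition gamma (R : realType) (n : nat) (S : 'M[R]_n) : R :=
  \sum_i \sum_j S i j.

Definition K (R : realType) (k n : nat) : set 'M[R]_(k, n) :=
  [set M | [/\ forall i j, 0 <= M i j,
               forall i, \sum_j M i j = n%:R / k%:R
             & forall j, \sum_i M i j = 1]].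
Arguments K R k n : clear implicits.

Definition C (R : realType) (n : nat) (S : 'M[R]_n) (k : nat) : set 'M[R]_k :=
  [set M *m S *m M^T | M in K R k n].
Arguments C {R n} S k.

(* The library norm on matrices is the entrywise maximum, not the l1 norm. *)
Definition l1norm (R : realType) (k : nat) (A : 'M[R]_k) : R :=
  \sum_i \sum_j `|A i j|.

(* Valued in the extended reals so that no default value of sup or inf can
   interfere; it is a finite real on nonempty bounded sets. *)
Definition dist (R : realType) (k : nat) (A B : set 'M[R]_k) : \bar R :=
  maxe (ereal_sup [set ereal_inf [set (l1norm (a - b))%:E | b in B] | a in A])
       (ereal_sup [set ereal_inf [set (l1norm (a - b))%:E | a in A] | b in B]).

(* A power of k (k > 0) is at least 1, so one can lie strictly below this
   number only if it exceeds 1. That fails when c = 0, and when eps is large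
   compared with c; the theorem therefore assumes 1 < size_bound. *)
Definition size_bound (R : realType) (c eps : R) (k : nat) : R :=
  4 * c / eps * (k%:R `^ ((2 * c * k%:R ^+ 2 / eps) ^+ (k ^ 2))).

(* Main.v *)
Require Import Defs.
From HB Require Import structures.
From mathcomp Require Import all_boot all_order all_algebra.
From mathcomp Require Import all_classical all_reals all_analysis.
From mathcomp Require Import ring lra.

Set Implicit Arguments.
Unset Strict Implicit.
Unset Printing Implicit Defensive.

Import Order.TTheory GRing.Theory Num.Theory.

Local Open Scope classical_set_scope.
Local Open Scope ring_scope.

(** Write X = N S N^T with N in K(m, n). Since P N lies in K(k, n) for every P
    in K(k, m), the set C(X, k) is always contained in C(S, k); what has to be
    arranged is that every M S M^T with M in K(k, n) is within eps of C(X, k).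

    All elements of C(S, k) are non-negative with sum c, so rounding entries
    down to a grid of step h sorts C(S, k) into finitely many cells, of l1
    diameter at most k^2 h ([finite_cells]). Choosing one M_s for each occupied
    cell s, it is enough that one N serves the finitely many M_s simultaneously.

    Regard a column of M_s as a probability distribution on k parts. The
    products A_f = prod_s M_s(f s, .), over all functions f from cells to parts,
    form a common refinement: M_s(i, .) is the sum of the A_f with f s = i. With
    t cells there are k^t such rows, but their weights w_f are arbitrary, while
    the rows of N must all have weight n / m. Put delta = k^t / m, keep the
    fraction 1 - delta of each A_f and spread it evenly over
    floor((1 - delta) w_f m / n) + 1 rows of N. Rounding up wastes at most one
    row per f, so at most k^t = delta m rows in total, and at most delta m / k
    among the k^(t - 1) functions f with f s = i. Hence everything fits in m
    rows, and the rows used by part i of M_s do not exceed its quota m / k. The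
    remaining mass of N, and that of the matrix P_s which regroups rows into
    parts, is filled in arbitrarily ([K_extend]), and P_s N >= (1 - delta) M_s
    entrywise ([common_refinement]).

    This entrywise bound controls the error whatever S is: it gives
    P_s N S (P_s N)^T >= (1 - delta)^2 M_s S M_s^T, and since both congruences
    have sum c, they differ by at most 2 (1 - (1 - delta)^2) c <= 4 delta c in
    the l1 norm ([l1norm_congr_le]).

    Finally eps is divided into 3 eps / 4 for the cells and eps / 4 for delta.
    With y = 2 c k^2 / eps this makes t = (floor(2 y / 3) + 1)^(k^2), which is
    at most y^(k^2) - 3 as soon as k > 1 and eps < 2 c ([cell_count_le]); the
    margin 3 pays for the constants and for rounding m up to a power of k. If
    k = 1 or eps >= 2 c, then C(S, k) has diameter at most eps and m = 1 works. *)

(** * Congruences by matrices of K *)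

Section Congruences.
Variable R : realType.

Lemma congrE (k n : nat) (M : 'M[R]_(k, n)) (S : 'M[R]_n) i j :
  (M *m S *m M^T) i j = \sum_b \sum_a M i a * S a b * M j b.
Proof.
rewrite mxE; apply: eq_bigr => b _.
by rewrite !mxE big_distrl.
Qed.

(** This form turns the invariance of [gamma] under K into associativity. *)
Lemma gammaE (n : nat) (S : 'M[R]_n) :
  gamma S = ((const_mx 1 : 'rV_n) *m S *m (const_mx 1 : 'rV_n)^T) 0 0.
Proof.
rewrite congrE /gamma exchange_big; apply: eq_bigr => b _.
by apply: eq_bigr => a _; rewrite !mxE mul1r mulr1.
Qed.

Lemma gamma_congr (k n : nat) (M : 'M[R]_(k, n)) (S : 'M[R]_n) :
  K R k n M -> gamma (M *m S *m M^T) = gamma S.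
Proof.
case=> _ _ M1.
have uM : (const_mx 1 : 'rV_k) *m M = const_mx 1.
  apply/rowP=> j; rewrite !mxE -[RHS](M1 j).
  by apply: eq_bigr => i _; rewrite mxE mul1r.
by rewrite !gammaE !mulmxA uM -!mulmxA -trmx_mul uM mulmxA.
Qed.

Lemma congr_ge0 (k n : nat) (M : 'M[R]_(k, n)) (S : 'M[R]_n) :
  (forall i j, 0 <= S i j) -> (forall i j, 0 <= M i j) ->
  forall i j, 0 <= (M *m S *m M^T) i j.
Proof.
move=> S0 M0 i j; rewrite congrE; apply: sumr_ge0 => b _.
by apply: sumr_ge0 => a _; rewrite !mulr_ge0.
Qed.

Lemma K_mul (p m n : nat) (P : 'M[R]_(p, m)) (N : 'M[R]_(m, n)) :
  (0 < m)%N -> K R p m P -> K R m n N -> K R p n (P *m N).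
Proof.
move=> m0 [P0 Pr Pc] [N0 Nr Nc]; split.
- by move=> i j; rewrite mxE sumr_ge0 // => r _; rewrite mulr_ge0.
- move=> i; under eq_bigr do rewrite mxE.
  rewrite exchange_big /=.
  under eq_bigr do rewrite -big_distrr /= Nr.
  rewrite -big_distrl /= Pr.
  by rewrite mulrC mulrA divfK // pnatr_eq0 -lt0n.
- move=> j; under eq_bigr do rewrite mxE.
  rewrite exchange_big /= -[RHS](Nc j).
  by apply: eq_bigr => r _; rewrite -big_distrl /= Pc mul1r.
Qed.

Lemma C_sub (n m k : nat) (S : 'M[R]_n) (X : 'M[R]_m) :
  (0 < m)%N -> C S m X -> C X k `<=` C S k.
Proof.
move=> m0 [N NK <-] _ [P PK <-]; exists (P *m N); first exact: K_mul.
by rewrite trmx_mul !mulmxA.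
Qed.

Lemma K_uniform (k n : nat) : (0 < k)%N -> K R k n (const_mx k%:R^-1).
Proof.
move=> k0; split=> [i j|i|j].
- by rewrite mxE invr_ge0 ler0n.
- under eq_bigr do rewrite mxE.
  by rewrite sumr_const card_ord -[LHS]mulr_natl.
- under eq_bigr do rewrite mxE.
  by rewrite sumr_const card_ord -[LHS]mulr_natl divff // pnatr_eq0 -lt0n.
Qed.

Lemma dist_le (n m k : nat) (S : 'M[R]_n) (X : 'M[R]_m) (eps : R) :
  (0 < m)%N -> 0 <= eps -> C S m X ->
  (forall b, C S k b -> exists2 a, C X k a & l1norm (a - b) <= eps) ->
  (dist (C X k) (C S k) <= eps%:E)%E.
Proof.
move=> m0 e0 CX H; rewrite /dist ge_max; apply/andP; split.
- apply: ge_ereal_sup => _ [a Ca <-].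
  apply: ge_ereal_inf; exists (l1norm (a - a))%:E.
    by exists a; first exact: C_sub Ca.
  rewrite lee_fin; apply: le_trans e0.
  by rewrite subrr /l1norm big1 // => i _; rewrite big1 // => j _; rewrite mxE normr0.
- apply: ge_ereal_sup => _ [b Cb <-].
  have [a Ca le] := H b Cb.
  apply: le_trans (_ : ((l1norm (a - b))%:E <= _)%E); last by rewrite lee_fin.
  by apply: ereal_inf_lbound; exists a.
Qed.

(** * Distances between congruences *)

(** Two non-negative matrices with the same sum that share a common part
    [theta *: B] can only differ in the rest, which weighs [1 - theta] times the
    sum on either side. *)
Lemma l1norm_le_dominated (k : nat) (A B : 'M[R]_k) (theta : R) :
  gamma A = gamma B -> theta <= 1 ->
  (forall i j, 0 <= B i j) -> (forall i j, theta * B i j <= A i j) ->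
  l1norm (A - B) <= 2 * (1 - theta) * gamma B.
Proof.
move=> gAB th1 B0 BA.
apply: (@le_trans _ _ (\sum_i \sum_j ((A i j - theta * B i j) + (1 - theta) * B i j))).
  apply: ler_sum => i _; apply: ler_sum => j _; rewrite !mxE.
  have := B0 i j; have := BA i j => h1 h2.
  have -> : A i j - B i j = (A i j - theta * B i j) - (1 - theta) * B i j by ring.
  apply: le_trans (ler_normB _ _) _.
  by rewrite !ger0_norm ?subr_ge0 // mulr_ge0 // subr_ge0.
have -> : \sum_i \sum_j (A i j - theta * B i j + (1 - theta) * B i j) =
   gamma A + (1 - 2 * theta) * gamma B.
  rewrite /gamma mulr_sumr -big_split; apply: eq_bigr => i _.
  rewrite mulr_sumr -big_split; apply: eq_bigr => j _ /=; ring.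
by rewrite gAB le_eqVlt; apply/orP; left; apply/eqP; ring.
Qed.

(** The bound depends on [S] only through [gamma S]: a perturbation of [M] that is
    small in norm would not do, since it could sit where [S] is concentrated,
    whereas a multiplicative lower bound survives the congruence. *)
Lemma l1norm_congr_le (k n : nat) (S : 'M[R]_n) (M M' : 'M[R]_(k, n)) (delta : R) :
  (forall i j, 0 <= S i j) -> K R k n M -> K R k n M' ->
  0 <= delta <= 1 -> (forall i j, (1 - delta) * M i j <= M' i j) ->
  l1norm (M' *m S *m M'^T - M *m S *m M^T) <= 4 * delta * gamma S.
Proof.
move=> S0 MK M'K /andP[d0 d1] MM'; have [M0 _ _] := MK.
have g0 : 0 <= gamma S by apply: sumr_ge0 => i _; apply: sumr_ge0.
apply: le_trans (_ : 2 * (1 - (1 - delta) ^+ 2) * gamma S <= _).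
  rewrite -(gamma_congr S MK); apply: l1norm_le_dominated.
  - by rewrite !gamma_congr.
  - by rewrite expr_le1 ?subr_ge0 // gerBl.
  - exact: congr_ge0.
  - move=> i j; rewrite !congrE mulr_sumr; apply: ler_sum => b _.
    rewrite mulr_sumr; apply: ler_sum => a _.
    have -> : (1 - delta) ^+ 2 * (M i a * S a b * M j b) =
      ((1 - delta) * M i a) * S a b * ((1 - delta) * M j b) by ring.
    by rewrite !ler_pM // ?mulr_ge0 // ?subr_ge0.
by rewrite ler_wpM2r //; nra.
Qed.

(** * A common refinement of finitely many elements of K *)

(** The missing row sums and the missing column sums have the same total [E], so
    the deficit is filled by the rank-one matrix of their products over [E]. *)
Lemma K_extend (p q : nat) (D : 'M[R]_(p, q)) :
  (0 < p)%N -> (forall i j, 0 <= D i j) ->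
  (forall i, \sum_j D i j <= q%:R / p%:R) -> (forall j, \sum_i D i j <= 1) ->
  exists2 P, K R p q P & forall i j, D i j <= P i j.
Proof.
move=> p0 D0 Dr Dc.
pose u i := q%:R / p%:R - \sum_j D i j; pose v j := 1 - \sum_i D i j.
pose E := \sum_i u i.
have u0 i : 0 <= u i by rewrite subr_ge0.
have v0 j : 0 <= v j by rewrite subr_ge0.
have E0 : 0 <= E by apply: sumr_ge0.
have Ev : E = \sum_j v j.
  rewrite /E /u /v !big_split /= !sumr_const !card_ord !sumrN exchange_big /=.
  by rewrite -[X in X - _]mulr_natr divfK // pnatr_eq0 -lt0n.
(* If E = 0, division by E returns 0, but then all deficits vanish as well. *)
have eq0 (T : finType) (w : T -> R) : (forall x, 0 <= w x) -> E = \sum_x w x ->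
  forall x, w x * E / E = w x.
  move=> w0 Ew x; have [EE|nE] := eqVneq E 0; last by rewrite mulfK.
  suff -> : w x = 0 by rewrite !mul0r.
  by apply: (@psumr_eq0P _ _ xpredT w) => //; rewrite -Ew.
exists (\matrix_(i, j) (D i j + u i * v j / E)); last first.
  by move=> i j; rewrite mxE lerDl divr_ge0 ?mulr_ge0.
split=> [i j|i|j].
- by rewrite mxE addr_ge0 ?divr_ge0 ?mulr_ge0.
- under eq_bigr do rewrite mxE.
  rewrite big_split /= -mulr_suml -mulr_sumr -Ev eq0 //.
  by rewrite addrC subrK.
- under eq_bigr do rewrite mxE.
  rewrite big_split /= -mulr_suml -mulr_suml mulrC -/E.
  by rewrite mulrC [E * _]mulrC eq0 // addrC subrK.
Qed.

(** The rows of [N] are handed out to the atoms [f], [s f] rows to each; the rows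
    sent to [None] are the spare ones. Stating this as a change of summation
    index is what every later row and column count uses. *)
Lemma exists_fibers_of_size (F : finType) (s : F -> nat) (m : nat) :
  (\sum_f s f <= m)%N ->
  exists g : 'I_m -> option F, forall phi : F -> R,
    \sum_r oapp phi 0 (g r) = \sum_f (s f)%:R * phi f.
Proof.
move=> sm.
pose L := flatten [seq nseq (s f) f | f <- enum F].
have sL : size L = (\sum_f s f)%N.
  rewrite size_flatten /shape -map_comp sumnE big_map big_enum /=.
  by apply: eq_bigr => f _; rewrite size_nseq.
pose L' := map Some L ++ nseq (m - size L) None.
have sL' : size L' = m by rewrite size_cat size_map size_nseq subnKC // sL.
exists (fun r => nth None L' r) => phi.
rewrite -(big_mkord xpredT (fun r => oapp phi 0 (nth None L' r))) -{1}sL'.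
rewrite -(big_nth None xpredT (oapp phi 0)) big_cat big_map big_flatten big_map /=.
rewrite big_enum [X in _ + X]big1_seq ?addr0; last first.
  by move=> x /= /nseqP[-> _].
by apply: eq_bigr => f _; rewrite big_nseq iter_addr_0 mulr_natl.
Qed.

(** In probabilistic terms, this is the [s]-th marginal of a product of
    distributions. It follows from the distributivity of product over sum, after
    the factor at [s] is multiplied by the indicator of [i]. *)
Lemma sum_prod_choice (I : finType) (k : nat) (a : I -> 'I_k -> R) s i :
  (forall s', \sum_i a s' i = 1) ->
  \sum_(f : {ffun I -> 'I_k} | f s == i) \prod_s' a s' (f s') = a s i.
Proof.
move=> a1.
pose F s' j := if s' == s then (j == i)%:R * a s' j else a s' j.
transitivity (\prod_s' \sum_j F s' j).
  rewrite bigA_distr_bigA /= big_mkcond; apply: eq_bigr => f _.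
  rewrite (bigD1 s) //= [in RHS](bigD1 s) //=.
  have -> : \prod_(s' | s' != s) F s' (f s') = \prod_(s' | s' != s) a s' (f s').
    by apply: eq_bigr => s' /negPf ns; rewrite /F ns.
  by rewrite /F eqxx; case: eqP => _; rewrite ?mul1r // !mul0r.
rewrite (bigD1 s) //= [X in _ * X]big1 => [|s' /negPf ns].
  rewrite /F eqxx mulr1 (bigD1 i) //= eqxx mul1r big1 ?addr0 // => j /negPf ->.
  by rewrite mul0r.
by rewrite /F ns.
Qed.

(** The loss [k ^ #|I| / m] is the number of atoms over the number of rows: each
    atom may waste one row by rounding. *)
Lemma common_refinement (I : finType) (k n m : nat) (M : I -> 'M[R]_(k, n)) :
  (0 < n)%N -> (0 < k)%N -> (k ^ #|I| <= m)%N -> (forall s, K R k n (M s)) ->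
  exists2 N, K R m n N &
    forall s, exists2 P, K R k m P &
      forall i j, (1 - (k ^ #|I|)%:R / m%:R) * M s i j <= (P *m N) i j.
Proof.
move=> n0 k0 ktm MK.
have m0 : (0 < m)%N by apply: leq_trans ktm; rewrite expn_gt0 k0.
have nR : 0 < n%:R :> R by rewrite ltr0n.
have kR : 0 < k%:R :> R by rewrite ltr0n.
have mR : 0 < m%:R :> R by rewrite ltr0n.
set delta := _ / m%:R.
have d1 : 0 <= 1 - delta by rewrite subr_ge0 ler_pdivrMr // mul1r ler_nat.
have dm : delta * m%:R = k%:R ^+ #|I| by rewrite divfK ?natrX ?gt_eqF.
pose F := {ffun I -> 'I_k}.
pose A (f : F) j := \prod_s M s (f s) j.
have A0 f j : 0 <= A f j.
  by apply: prodr_ge0 => s _; have [M0 _ _] := MK s.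
have marg s i j : \sum_(f : F | f s == i) A f j = M s i j.
  apply: (sum_prod_choice (a := fun s i => M s i j)) => s'.
  by have [_ _] := MK s'.
have tot j : \sum_f A f j = 1.
  rewrite -(bigA_distr_bigA (fun s i => M s i j)) big1 // => s _.
  by have [_ _] := MK s.
pose w f := \sum_j A f j.
have w0 f : 0 <= w f by apply: sumr_ge0.
pose x f := (1 - delta) * w f * (m%:R / n%:R).
have x0 f : 0 <= x f by rewrite !mulr_ge0 ?invr_ge0.
(* The x f full rows that atom f would need, rounded up; the successor of the
   integer part rather than the ceiling, so that s f > 0 even if w f = 0. *)
pose s f := (Num.truncn (x f)).+1.
have xs f : x f < (s f)%:R by exact: truncnS_gt.
have sx f : (s f)%:R <= x f + 1.
  by rewrite /s -natr1 lerD2r truncn_le.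
have sR f : 0 < (s f)%:R :> R by rewrite ltr0n.
have sum_s : (\sum_f s f <= m)%N.
  rewrite -(ler_nat R) natr_sum.
  apply: le_trans (ler_sum _ (fun f _ => sx f)) _.
  rewrite big_split /= -mulr_suml -mulr_sumr exchange_big /=.
  under eq_bigr do rewrite tot.
  rewrite !sumr_const card_ord card_ffun card_ord natrX -dm.
  by rewrite le_eqVlt; apply/orP; left; apply/eqP; field; rewrite gt_eqF.
(* The bound on a fibre is exactly the row sum required of P. *)
have sum_s_fiber t i : \sum_(f : F | f t == i) (s f)%:R <= m%:R / k%:R :> R.
  apply: le_trans (ler_sum _ (fun f _ => sx f)) _.
  rewrite big_split /= -mulr_suml -mulr_sumr exchange_big /=.
  under eq_bigr do rewrite marg.
  have [_ -> _] := MK t.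
  (* Counting the fibre is the marginal identity for uniform distributions. *)
  have -> : \sum_(f : F | f t == i) 1 = delta * m%:R / k%:R :> R.
    have h := @sum_prod_choice I k (fun _ _ => k%:R^-1) t i.
    rewrite dm -[X in _ * X]h => [|_]; last first.
      by rewrite sumr_const card_ord -[LHS]mulr_natl divff ?gt_eqF.
    rewrite mulr_sumr; apply: eq_bigr => f _.
    by rewrite prodr_const exprVn divff // expf_neq0 ?gt_eqF.
  by rewrite le_eqVlt; apply/orP; left; apply/eqP; field; rewrite !gt_eqF.
have [g gP] := exists_fibers_of_size sum_s.
(* The part of N made of atoms; the rest of each row is filler. *)
pose v := \matrix_(r < m, j < n) oapp (fun f => (1 - delta) / (s f)%:R * A f j) 0 (g r).
have vf_ge0 f : 0 <= (1 - delta) / (s f)%:R by rewrite divr_ge0.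
have v0 r j : 0 <= v r j.
  by rewrite mxE; case: (g r) => [f|] //=; rewrite mulr_ge0.
have [] := @K_extend m n v m0 v0.
- move=> r; under eq_bigr do rewrite mxE.
  case: (g r) => [f|] /=; last by rewrite big1 // divr_ge0.
  rewrite -mulr_sumr -/(w f) mulrAC ler_pdivrMr //.
  have -> : (1 - delta) * w f = x f * (n%:R / m%:R) by rewrite /x; field; rewrite !gt_eqF.
  by rewrite [leRHS]mulrC ler_wpM2r ?divr_ge0 // ltW.
- move=> j; under eq_bigr do rewrite mxE.
  rewrite gP; under eq_bigr do rewrite mulrA [X in X * _]mulrC divfK ?gt_eqF //.
  by rewrite -mulr_sumr tot mulr1 gerBl divr_ge0.
move=> N NK vN; exists N => // t.
(* D sends the rows of an atom to the part that M t assigns to it. *)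
pose D := \matrix_(i < k, r < m) oapp (fun f : F => (f t == i)%:R : R) 0 (g r).
have D0 i r : 0 <= D i r by rewrite mxE; case: (g r).
have [] := @K_extend k m D k0 D0.
- move=> i; under eq_bigr do rewrite mxE.
  rewrite gP; apply: le_trans (sum_s_fiber t i).
  rewrite [leRHS]big_mkcond; apply: ler_sum => f _.
  by case: eqP; rewrite ?mulr1 ?mulr0.
- move=> r; under eq_bigr do rewrite mxE.
  case: (g r) => [f|] /=; last by rewrite big1.
  rewrite (bigD1 (f t)) //= eqxx big1 ?addr0 // => i.
  by rewrite eq_sym => /negPf ->.
move=> P PK DP; exists P => // i j.
rewrite mxE; apply: (@le_trans _ _ (\sum_r D i r * v r j)); last first.
  by apply: ler_sum => r _; rewrite ler_pM.
pose phi (f : F) := (f t == i)%:R * ((1 - delta) / (s f)%:R * A f j).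
have -> : \sum_r D i r * v r j = \sum_r oapp phi 0 (g r).
  by apply: eq_bigr => r _; rewrite !mxE; case: (g r) => //=; rewrite mul0r.
rewrite gP -marg mulr_sumr big_mkcond; apply: ler_sum => f _; rewrite /phi.
case: eqP => _; last by rewrite mul0r mulr0.
by rewrite mul1r mulrA [X in _ <= X * _]mulrC divfK // gt_eqF.
Qed.

Lemma entry_le_gamma (k : nat) (A : 'M[R]_k) i j :
  (forall i j, 0 <= A i j) -> A i j <= gamma A.
Proof.
move=> A0; rewrite /gamma (bigD1 i) //= (bigD1 j) //= -addrA lerDl.
by rewrite addr_ge0 ?sumr_ge0 // => i' _; rewrite ?sumr_ge0.
Qed.

(** * Finitely many cells suffice *)

(** Only a map to a finite type is needed later, so the cells are not described
    as subsets: [cell A] records the integer parts of the entries of [A / h]. *)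
Lemma finite_cells (k : nat) (c h : R) : 0 < h ->
  exists cell : 'M[R]_k -> {ffun 'I_k * 'I_k -> 'I_(Num.truncn (c / h)).+1},
    forall A B : 'M[R]_k,
      (forall i j, 0 <= A i j) -> (forall i j, 0 <= B i j) ->
      gamma A = c -> gamma B = c -> cell A = cell B ->
      l1norm (A - B) <= (k ^ 2)%:R * h.
Proof.
move=> h0.
exists (fun A : 'M[R]_k => [ffun p => inord (Num.truncn (A p.1 p.2 / h))]).
have small (A : 'M[R]_k) i j : (forall i j, 0 <= A i j) -> gamma A = c ->
    (Num.truncn (A i j / h) < (Num.truncn (c / h)).+1)%N.
  move=> A0 Ac; rewrite ltnS; apply: le_truncn.
  by rewrite ler_pM2r ?invr_gt0 // -Ac; exact: entry_le_gamma.
move=> A B A0 B0 Ac Bc eqAB.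
apply: (@le_trans _ _ (\sum_(i < k) \sum_(j < k) h)); last first.
  by rewrite !sumr_const !card_ord -mulrnA mulr_natl mulnn.
apply: ler_sum => i _; apply: ler_sum => j _; rewrite !mxE.
move/ffunP/(_ (i, j))/(congr1 val): eqAB.
rewrite !ffunE /= !inordK ?small // => eqt.
have /andP[] := truncn_itv (divr_ge0 (A0 i j) (ltW h0)).
have /andP[] := truncn_itv (divr_ge0 (B0 i j) (ltW h0)).
rewrite -eqt -!natr1 !(ler_pdivlMr, ltr_pdivrMr) // => b1 b2 a1 a2.
by rewrite ler_norml; apply/andP; split; lra.
Qed.

Lemma l1norm_le2gamma (k : nat) (A B : 'M[R]_k) :
  (forall i j, 0 <= A i j) -> (forall i j, 0 <= B i j) -> gamma A = gamma B ->
  l1norm (A - B) <= 2 * gamma B.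
Proof.
move=> A0 B0 AB; rewrite -[2]mulr1 -[X in 2 * X]subr0.
by apply: l1norm_le_dominated => // i j; rewrite mul0r.
Qed.

Lemma l1norm_triangle (k : nat) (A B D : 'M[R]_k) :
  l1norm (A - D) <= l1norm (A - B) + l1norm (B - D).
Proof.
rewrite /l1norm -big_split; apply: ler_sum => i _.
rewrite -big_split; apply: ler_sum => j _ /=.
by rewrite !mxE; apply: ler_distD.
Qed.

(** The exponent of [k] is the number of cells plus [l]; the two error terms come
    from the waste [delta = k ^- l] of the refinement and from the diameter of a
    cell. *)
Lemma exists_refining_congruence (n : nat) (S : 'M[R]_n) (k l : nat) (h : R) :
  (forall i j, 0 <= S i j) -> (0 < n)%N -> (0 < k)%N -> 0 < h ->
  exists2 X, C S (k ^ ((Num.truncn (gamma S / h)).+1 ^ (k ^ 2) + l))%N X &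
    forall B, C S k B -> exists2 A, C X k A &
      l1norm (A - B) <= 4 * (k ^ l)%:R^-1 * gamma S + (k ^ 2)%:R * h.
Proof.
move=> S0 n0 k0 h0; set q := (Num.truncn _).+1; set m := (k ^ _)%N.
have [cell cellP] := @finite_cells k (gamma S) h h0.
pose I := {ffun 'I_k * 'I_k -> 'I_q}.
have cI : #|I| = (q ^ (k ^ 2))%N by rewrite card_ffun card_prod !card_ord mulnn.
(* A cell that C S k misses gets the uniform matrix, an arbitrary choice. *)
have /choice[M MP] : forall z : I, exists M, K R k n M /\
    ((exists2 M', K R k n M' & cell (M' *m S *m M'^T) = z) ->
     cell (M *m S *m M^T) = z).
  move=> z.
  have [[M' M'K M'z]|nex] := pselect (exists2 M', K R k n M' & cell (M' *m S *m M'^T) = z).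
    by exists M'.
  by exists (const_mx k%:R^-1); split => //; exact: K_uniform.
have MK z : K R k n (M z) by have [] := MP z.
have ktm : (k ^ #|I| <= m)%N by rewrite cI leq_pexp2l // leq_addr.
have [N NK NP] := common_refinement n0 k0 ktm MK.
exists (N *m S *m N^T); first by exists N.
move=> _ [M' M'K <-]; pose z := cell (M' *m S *m M'^T).
have [P PK PN] := NP z.
have m0 : (0 < m)%N by rewrite expn_gt0 k0.
exists ((P *m N) *m S *m (P *m N)^T).
  by exists P => //; rewrite trmx_mul !mulmxA.
apply: le_trans (l1norm_triangle _ (M z *m S *m (M z)^T) _) _.
apply: lerD.
  have dE : (k ^ #|I|)%:R / m%:R = (k ^ l)%:R^-1 :> R.
    by rewrite /m expnD -cI natrM invfM mulrA divff ?mul1r // pnatr_eq0 -lt0n expn_gt0 k0.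
  apply: l1norm_congr_le => //; first exact: K_mul.
    by rewrite invr_ge0 ler0n invf_le1 ?ltr0n ?ler1n expn_gt0 k0.
  by move=> i j; rewrite -dE.
have [M'0 _ _] := M'K; have [Mz0 _ _] := MK z.
apply: cellP; rewrite ?gamma_congr //; try exact: congr_ge0.
by have [_ ->] := MP z; last by exists M'.
Qed.

(** * Choice of the parameters *)

(** Rounding up to a power of [k] costs a factor less than [k]. *)
Lemma pow_between (k : nat) (W : R) : (1 < k)%N -> 1 < W ->
  exists l, W <= (k ^ l)%:R /\ (k ^ l)%:R < k%:R * W.
Proof.
move=> k1 W1.
have ex : exists l, W <= (k ^ l)%:R.
  exists (Num.truncn W).+1; apply: ltW; apply: lt_le_trans (truncnS_gt W) _.
  by rewrite ler_nat ltnW // ltn_expl.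
case: (ex_minnP ex) => -[|l] Wl minl.
  by move: Wl; rewrite expn0 leNgt W1.
exists l.+1; split => //; rewrite expnS natrM ltr_pM2l ?ltr0n ?(ltnW k1) //.
by rewrite ltNge; apply/negP => /minl; rewrite ltnn.
Qed.

(** Applied with [d = k ^ 2] and [y = 2 * c * k ^ 2 / eps], where
    [2 / 3 * y = c / h] for the grid step [h = 3 * eps / (4 * k ^ 2)]. The base on
    the left is smaller than [y] by at least 1/3, and this gap is multiplied by
    [y ^+ (d - 1) >= 9] in the powers. *)
Lemma cell_count_le (d : nat) (y : R) : (4 <= d)%N -> 4 <= y ->
  ((Num.truncn (2 / 3 * y)).+1 ^ d + 3)%:R <= y ^+ d.
Proof.
move=> d4 y4; set q := _.+1.
have qy : q%:R <= y - 1 / 3.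
  have y0 : 0 <= 2 / 3 * y by lra.
  have : (Num.truncn (2 / 3 * y))%:R <= 2 / 3 * y by rewrite truncn_le.
  by rewrite /q -natr1; lra.
have q0 : 0 <= q%:R :> R by [].
case: d d4 => // d d4; rewrite natrD natrX !exprS.
have yd : 9 <= y ^+ d.
  apply: (@le_trans _ _ (y ^+ 2)); first by nra.
  have d2 : (2 <= d)%N by exact: ltnW d4.
  by rewrite ler_weXn2l //; lra.
have qd : q%:R ^+ d <= y ^+ d.
  by rewrite lerXn2r ?nnegrE //; lra.
have q1 : 0 <= q%:R ^+ d :> R by rewrite exprn_ge0.
nra.
Qed.

End Congruences.

Theorem proposition6p5 (R : realType) (n : nat) (S : 'M[R]_n) (c : R)
    (k : nat) (eps : R)
    (S_ge0 : forall i j, 0 <= S i j) (gammaS : gamma S = c)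
    (k_gt0 : (0 < k)%N) (eps_gt0 : 0 < eps)
    (bound_gt1 : 1 < size_bound c eps k) :
  exists m : nat,
    [/\ m%:R < size_bound c eps k,
        exists i : nat, m = (k ^ i)%N
      & exists X : 'M[R]_m, C S m X /\ (dist (C X k) (C S k) <= eps%:E)%E].
Proof.
(* For m = 1, every element of C(X, k) lies in C(S, k), which may be compared
   with all of C(S, k). *)
have trivial_case : (forall A B, C S k A -> C S k B -> l1norm (A - B) <= eps) ->
  exists m : nat,
    [/\ m%:R < size_bound c eps k,
        exists i : nat, m = (k ^ i)%N
      & exists X : 'M[R]_m, C S m X /\ (dist (C X k) (C S k) <= eps%:E)%E].
  move=> small; exists 1%N; split => //; first by exists 0%N.
  pose N := const_mx 1%:R^-1 : 'M[R]_(1, n).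
  have CX : C S 1 (N *m S *m N^T) by exists N => //; exact: K_uniform.
  exists (N *m S *m N^T); split => //.
  apply: dist_le => //; first exact: ltW.
  move=> B CB.
  pose P := const_mx k%:R^-1 : 'M[R]_(k, 1).
  have CA : C (N *m S *m N^T) k (P *m (N *m S *m N^T) *m P^T).
    by exists P => //; exact: K_uniform.
  by exists (P *m (N *m S *m N^T) *m P^T) => //; apply: small => //; exact: C_sub CA.
have C_ge0 A : C S k A -> forall i j, 0 <= A i j.
  by move=> [M [M0 _ _] <-]; exact: congr_ge0.
have C_gamma A : C S k A -> gamma A = c.
  by move=> [M MK <-]; rewrite gamma_congr.
have [k1|k2] := leqP k 1.
  have ke : k = 1%N by apply/eqP; rewrite eqn_leq k1.
  subst k; apply: trivial_case => A B /C_gamma Ac /C_gamma Bc.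
  move: Ac; rewrite -Bc /gamma /l1norm !big_ord1 !mxE => ->.
  by rewrite subrr normr0 ltW.
have [ceps|ceps] := leP (2 * c) eps.
  apply: trivial_case => A B CA CB; apply: le_trans ceps.
  by rewrite -(C_gamma B CB); apply: l1norm_le2gamma; rewrite ?C_gamma //; exact: C_ge0.
have c0 : 0 < c by lra.
have n0 : (0 < n)%N.
  case: n S S_ge0 gammaS {trivial_case C_ge0 C_gamma} => // S _.
  by rewrite /gamma big_ord0 => cE; move: c0; rewrite -cE ltxx.
have kR : 0 < k%:R :> R by rewrite ltr0n.
(* The constant 16 is what makes 4 c k^-l <= eps / 4. *)
have [l [Wl lW]] : exists l, 16 * c / eps <= (k ^ l)%:R /\
    (k ^ l)%:R < k%:R * (16 * c / eps).
  by apply: pow_between => //; rewrite ltr_pdivlMr //; lra.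
(* The grid step is chosen so that k^2 h = 3 eps / 4. *)
pose h := 3 * eps / (4 * (k ^ 2)%:R).
have k2R : 0 < (k ^ 2)%:R :> R by rewrite ltr0n expn_gt0 k_gt0.
have h0 : 0 < h by rewrite divr_gt0 ?mulr_gt0.
have [X CX XP] := exists_refining_congruence l S_ge0 n0 k_gt0 h0.
pose y := 2 * c * k%:R ^+ 2 / eps.
have y4 : 4 <= y.
  rewrite ler_pdivlMr // -natrX.
  have : 4 <= (k ^ 2)%:R :> R by rewrite (ler_nat _ 4) (leq_sqr 2).
  nra.
have ye : gamma S / h = 2 / 3 * y.
  by rewrite gammaS /h /y -natrX; field; rewrite !gt_eqF.
set m := (k ^ _)%N in X CX XP.
have m0 : (0 < m)%N by rewrite expn_gt0 k_gt0.
exists m; split; first last.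
- exists X; split => //; apply: dist_le => //; first exact: ltW.
  move=> B /XP[A CA AB]; exists A => //; apply: le_trans AB _.
  have -> : (k ^ 2)%:R * h = 3 / 4 * eps by rewrite /h; field; rewrite gt_eqF.
  have kl0 : 0 < (k ^ l)%:R :> R by rewrite ltr0n expn_gt0 k_gt0.
  suff : 4 * (k ^ l)%:R^-1 * gamma S <= eps / 4 by lra.
  rewrite gammaS mulrAC ler_pdivrMr //.
  by move: Wl; rewrite ler_pdivrMr //; lra.
- by eexists.
have d4 : (4 <= k ^ 2)%N by rewrite (leq_sqr 2).
have := cell_count_le d4 y4; rewrite -ye; set t := (_ ^ _)%N => ty.
have -> : m = (k ^ t * k ^ l)%N by rewrite -expnD.
apply: (@lt_le_trans _ _ (4 * c / eps * k%:R ^+ (t + 3))); last first.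
  rewrite /size_bound ler_pM2l ?divr_gt0 ?mulr_gt0 //.
  by rewrite -powR_mulrn //; apply: ler_powR => //; rewrite ler1n.
rewrite natrM natrX exprD.
have kt : 0 < k%:R ^+ t :> R by rewrite exprn_gt0.
have -> : 4 * c / eps * (k%:R ^+ t * k%:R ^+ 3) = k%:R ^+ t * (4 * c / eps * k%:R ^+ 3) by ring.
rewrite ltr_pM2l //; apply: lt_le_trans lW _.
have -> : k%:R * (16 * c / eps) = 4 * c / eps * (4 * k%:R) by ring.
rewrite ler_pM2l ?divr_gt0 ?mulr_gt0 //.
rewrite exprS mulrC ler_pM2l // -natrX (ler_nat _ 4) //.
Qed.
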